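(* In the stochastic production model with many inputs described in the context, the expected output $\Phi$ is monotonic: for contract tuples $\mathbf{P}=(P^h)_{h\in H}$ and $\mathbf{Q}=(Q^h)_{h\in H}$, $\mathbf{P}\succeq\mathbf{Q}$ implies $\Phi(\mathbf{P})\ge\Phi(\mathbf{Q})$. In particular, the coarse tuple $\mathbf{C}=(C^h)_{h\in H}$, in which $C^h$ is the partition of $K^h$ into a single shipment, maximizes the expected output over all contract tuples.
   Context: $K$ is a finite set of commodities and $H$ a finite set of suppliers. Each $h\in H$ has a subset $K^h\subseteq K$ (not necessarily disjoint for different $h$) and a probability $p_h\in[0,1]$. A shipping contract with $h$ is a partition $P^h$ of $K^h$ into disjoint parts $K^h=K^h_1\sqcup\cdots\sqcup K^h_l$, called shipments; a contract tuple is $\mathbf{P}=(P^h)_{h\in H}$. Each shipment of supplier $h$ arrives with probability $p_h$, all arrivals (across suppliers and across shipments of the same supplier) being independent; when a shipment arrives, all the commodities in it arrive from $h$, and when it does not, none of them do. For $k\in K$, $S_k\subseteq H$ is the random set of suppliers $h$ with $k\in K^h$ whose shipment containing $k$ arrives. The output is $F(\mathbf{S})=\prod_{k\in K}F_k(S_k)$, where $\mathbf{S}=(S_k)_{k\in K}$ and the $F_k$ are given non-negative real-valued functions on subsets of $H$ that are increasing: $F_k(S)\ge F_k(S')$ whenever $S\supseteq S'$. $\Phi(\mathbf{P})$ is the expectation of $F(\mathbf{S})$ under the contract tuple $\mathbf{P}$. Write $\mathbf{P}\succeq\mathbf{Q}$ if for every $h\in H$ the partition $P^h$ is coarser than $Q^h$,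 i.e. each part of $P^h$ is a union of parts of $Q^h$. *)

(* Defs.v *)
From mathcomp Require Import all_boot all_order all_algebra.

Set Implicit Arguments.
Unset Strict Implicit.
Unset Printing Implicit Defensive.

Import Order.TTheory GRing.Theory Num.Theory.
Local Open Scope ring_scope.

Section Model.

Variables (R : realFieldType) (K H : finType).

(* [P h] is the set of shipments of supplier [h].  The library's [partition]
   excludes empty parts. *)
Definition contract_tuple (Kh : H -> {set K}) (P : H -> {set {set K}}) : Prop :=
  forall h, partition (P h) (Kh h).

Definition coarser (P Q : {set {set K}}) : Prop :=
  forall B, B \in P -> exists2 D : {set {set K}}, D \subset Q & B = cover D.

Definition coarser_tuple (P Q : H -> {set {set K}}) : Prop :=
  forall h, coarser (P h) (Q h).

(* The only partition of the empty set has no part, hence the removal of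
   [set0] when [Kh h] is empty. *)
Definition coarse_tuple (Kh : H -> {set K}) (h : H) : {set {set K}} :=
  [set Kh h] :\ set0.

(* A shipment is tagged with its supplier, so that equal sets of commodities
   shipped by different suppliers remain distinct shipments. *)
Definition shipments (P : H -> {set {set K}}) : {set H * {set K}} :=
  [set s | s.2 \in P s.1].

(* An outcome is the set [A] of the shipments that arrive; the arrivals are
   independent Bernoulli variables, so the law of [A] is the product law
   (see [arrival_probE]). *)
Definition outcome_prob (p : H -> R) (P : H -> {set {set K}})
    (A : {set H * {set K}}) : R :=
  \prod_(s in shipments P) (if s \in A then p s.1 else 1 - p s.1).

Definition expectation (p : H -> R) (P : H -> {set {set K}})
    (X : {set H * {set K}} -> R) : R :=
  \sum_(A : {set H * {set K}} | A \subset shipments P) outcome_prob p P A * X A.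

Definition arrived_suppliers (Kh : H -> {set K}) (P : H -> {set {set K}})
    (A : {set H * {set K}}) (k : K) : {set H} :=
  [set h | (k \in Kh h) && ((h, pblock (P h) k) \in A)].

Definition output (F : K -> {set H} -> R) (S : K -> {set H}) : R :=
  \prod_(k : K) F k (S k).

Definition expected_output (Kh : H -> {set K}) (p : H -> R)
    (F : K -> {set H} -> R) (P : H -> {set {set K}}) : R :=
  expectation p P (fun A => output F (arrived_suppliers Kh P A)).

(* All the shipments in [J] arrive with probability the product of their
   arrival probabilities; for [J = set0] the total mass is 1. *)
Lemma arrival_probE (p : H -> R) (P : H -> {set {set K}})
    (J : {set H * {set K}}) :
  J \subset shipments P ->
  expectation p P (fun A => (J \subset A)%:R) = \prod_(s in J) p s.1.
Proof.
move=> sJ.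
pose f s := if s \in shipments P then p s.1 else 0.
pose g s := if s \in J then 0 else if s \in shipments P then 1 - p s.1 else 1.
have -> : \prod_(s in J) p s.1 = \prod_s (f s + g s).
  rewrite big_mkcond; apply: eq_bigr => s _; rewrite /f /g.
  case: ifP => [/(subsetP sJ) ->|_]; first by rewrite addr0.
  by case: ifP => _; rewrite ?add0r // addrC subrK.
rewrite bigA_distr /expectation big_mkcond; apply: eq_bigr => A _.
case: ifPn => [AP|/subsetPn[s sA sP]]; last first.
  by rewrite (bigD1 s) //= sA /f (negPf sP) mul0r.
case: (boolP (J \subset A)) => [JA|/subsetPn[s sJs sA]]; last first.
  by rewrite mulr0 (bigD1 s) //= (negPf sA) /g sJs mul0r.
rewrite mulr1 /outcome_prob big_mkcond; apply: eq_bigr => s _; rewrite /f /g.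
case: (boolP (s \in A)) => [/(subsetP AP) -> //|sA'].
by rewrite (negPf (contra (subsetP JA s) sA')).
Qed.

End Model.

(* Main.v *)
(** Each commodity [k] contributes a factor that is increasing in the arrivals
    of the shipments containing it, and it sees at most one shipment of each
    supplier.  Let the shipments be merged one at a time: the merger of [a]
    into [b] makes the factors that see [a] (they do not see [b]) read the
    arrival of [b] instead.  Calling [f] the product of these factors, [g] the
    product of the others, and [s] the exchange of [a] and [b], which preserves
    the law, symmetrization gives
    2 (E[f(sA) g(A)] - E[f(A) g(A)]) = E[(f(sA) - f(A)) (g(A) - g(sA))],
    and the integrand is nonnegative because both differences always have the
    same sign. *)

Require Import Defs.
From mathcomp Require Import all_boot all_order all_algebra perm.
From mathcomp Require Import ring.

Set Implicit Arguments.
Unset Strict Implicit.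
Unset Printing Implicit Defensive.

Import Order.TTheory GRing.Theory Num.Theory.
Local Open Scope ring_scope.

(** * Product Bernoulli laws and exchange of coordinates *)

Definition bernoulli_prob (R : realFieldType) (T : finType) (q : T -> R)
    (A : {set T}) : R :=
  \prod_i (if i \in A then q i else 1 - q i).

Definition bernoulli_expect (R : realFieldType) (T : finType) (q : T -> R)
    (X : {set T} -> R) : R :=
  \sum_A bernoulli_prob q A * X A.

Definition swap_set (T : finType) (a b : T) (A : {set T}) : {set T} :=
  tperm a b @^-1: A.

Lemma swap_setK (T : finType) (a b : T) : involutive (@swap_set T a b).
Proof. by move=> A; apply/setP=> i; rewrite !inE tpermK. Qed.

Lemma swap_set_id (T : finType) (a b : T) (A : {set T}) :
  (a \in A) = (b \in A) -> swap_set a b A = A.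
Proof. by move=> ab; apply/setP=> i; rewrite !inE; case: tpermP => [->|->|]. Qed.

Section Bernoulli.

Variables (R : realFieldType) (T : finType) (q : T -> R).
Hypothesis q01 : forall i, 0 <= q i <= 1.

Local Notation mu := (bernoulli_prob q).
Local Notation E := (bernoulli_expect q).

Lemma bernoulli_prob_ge0 (A : {set T}) : 0 <= mu A.
Proof.
apply: prodr_ge0 => i _; have /andP[q0 q1] := q01 i.
by case: ifP; rewrite ?subr_ge0.
Qed.

Lemma bernoulli_prob_swap (a b : T) (A : {set T}) :
  q a = q b -> mu (swap_set a b A) = mu A.
Proof.
move=> qab; rewrite /bernoulli_prob [RHS](reindex_inj (@perm_inj _ (tperm a b))).
by apply: eq_bigr => i _; rewrite inE; case: tpermP => [->|->|]; rewrite ?qab.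
Qed.

Lemma bernoulli_expect_swap (a b : T) (X : {set T} -> R) :
  q a = q b -> E (fun A => X (swap_set a b A)) = E X.
Proof.
move=> qab; rewrite /bernoulli_expect.
rewrite [RHS](reindex_inj (inv_inj (swap_setK a b))).
by apply: eq_bigr => A _; rewrite bernoulli_prob_swap.
Qed.

Lemma bernoulli_expect_swap_le (a b : T) (f g : {set T} -> R) :
    q a = q b ->
    (forall A : {set T}, a \in A -> b \notin A ->
       f (swap_set a b A) <= f A /\ g A <= g (swap_set a b A)) ->
  E (fun A => f A * g A) <= E (fun A => f (swap_set a b A) * g A).
Proof.
move=> qab fg; pose s := swap_set a b.
rewrite -subr_ge0 -(pmulr_rge0 _ (ltr0n R 2)).
have -> : 2 * (E (fun A => f (s A) * g A) - E (fun A => f A * g A)) =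
          E (fun A => (f (s A) - f A) * (g A - g (s A))).
  rewrite mulr_natl mulr2n.
  rewrite -{2}(bernoulli_expect_swap (fun A => f (s A) * g A) qab).
  rewrite -{2}(bernoulli_expect_swap (fun A => f A * g A) qab).
  rewrite /bernoulli_expect -!sumrB -big_split; apply: eq_bigr => A _ /=.
  rewrite -/s [s (s A)]swap_setK -!mulrBr -mulrDr; congr (_ * _).
  by ring.
apply: sumr_ge0 => A _; apply: mulr_ge0; first exact: bernoulli_prob_ge0.
case: (boolP (a \in A)) (boolP (b \in A)) => [aA|aA] [bA|bA].
- by rewrite /s swap_set_id ?aA ?bA // !subrr mulr0.
- by have [fA gA] := fg A aA bA; apply: mulr_le0; rewrite subr_le0.
(* Here [s A] contains [a] but not [b], so [fg] applies to it and both differences are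
   nonnegative. *)
- have [||fA gA] := fg (s A); rewrite ?inE ?tpermL ?tpermR //.
  by move: fA gA; rewrite [swap_set _ _ _]swap_setK => fA gA;
     apply: mulr_ge0; rewrite subr_ge0.
- by rewrite /s swap_set_id ?(negPf aA) ?(negPf bA) // !subrr mulr0.
Qed.

(* [V k] is the set of coordinates on which [X k] depends; the hypothesis on
   [X k] expresses both this dependence and monotonicity. *)
Lemma bernoulli_expect_merge_le (K : finType) (V : K -> {set T})
    (X : K -> {set T} -> R) (m : T -> T) :
    (forall k A, 0 <= X k A) ->
    (forall k (A B : {set T}), A :&: V k \subset B -> X k A <= X k B) ->
    (forall i, m (m i) = m i) -> (forall i, q (m i) = q i) ->
    (forall k, {in V k &, injective m}) ->
  E (fun A => \prod_k X k A) <= E (fun A => \prod_k X k (m @^-1: A)).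
Proof.
move=> X0 XV mm qm m_inj; pose ms (s : seq T) i := if i \in s then m i else i.
have XE k (A B : {set T}) : {in V k, A =i B} -> X k A = X k B.
  move=> AB; apply/eqP; rewrite eq_le !XV //; apply/subsetP=> i /setIP[].
    by move=> iB iV; rewrite AB.
  by move=> iA iV; rewrite -AB.
(* Induction on the list [s] of coordinates merged so far: [ms s] is [m] on [s] and the identity
   elsewhere. *)
suff /(_ (enum T)) : forall s : seq T,
    E (fun A => \prod_k X k A) <= E (fun A => \prod_k X k (ms s @^-1: A)).
  move/le_trans; apply; rewrite le_eqVlt; apply/orP; left; apply/eqP.
  apply: eq_bigr => A _; congr (_ * _); apply: eq_bigr => k _.
  by apply: XE => i _; rewrite !inE /ms mem_enum.
elim=> [|i s /le_trans]; last apply.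
  rewrite le_eqVlt; apply/orP; left; apply/eqP.
  apply: eq_bigr => A _; congr (_ * _); apply: eq_bigr => k _.
  by apply: XE => i _; rewrite !inE /ms.
have [triv|] := boolP ((i \in s) || (m i == i)).
  rewrite le_eqVlt; apply/orP; left; apply/eqP.
  apply: eq_bigr => A _; congr (_ * _); apply: eq_bigr => k _.
  apply: XE => j _; rewrite !inE /ms inE.
  by case: eqVneq => [->|//]; case: ifP triv => //= _ /eqP->.
rewrite negb_or => /andP[i_s mi].
have msi : ms s i = i by rewrite /ms (negPf i_s).
(* As [m] is idempotent and moves [i], the point [i] is not in its image: only [i] itself reads the
   arrival of [i]. *)
have ms_neq j : j != i -> ms s j != i.
  rewrite /ms; case: ifP => // _ _; apply: contra mi => /eqP <-.
  by rewrite mm.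
(* By injectivity of [m] on [V k], a factor that sees [i] does not yet read [m i]. *)
have ms_neq_m k j : i \in V k -> j \in V k -> j != i -> ms s j != m i.
  move=> iV jV; apply: contra => /eqP msj; apply/eqP/(m_inj k) => //.
  by move: msj; rewrite /ms; case: ifP => // _ ->; rewrite mm.
pose f (A : {set T}) := \prod_(k | i \in V k) X k (ms s @^-1: A).
pose g (A : {set T}) := \prod_(k | i \notin V k) X k (ms s @^-1: A).
have -> : E (fun A => \prod_k X k (ms s @^-1: A)) = E (fun A => f A * g A).
  by apply: eq_bigr => A _; rewrite (bigID (fun k => i \in V k)).
have -> : E (fun A => \prod_k X k (ms (i :: s) @^-1: A)) =
          E (fun A => f (swap_set i (m i) A) * g A).
  apply: eq_bigr => A _; rewrite (bigID (fun k => i \in V k)) /=.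
  congr (_ * (_ * _)); apply: eq_bigr => k iV; apply: XE => j jV; rewrite !inE.
    have [->|ji] := eqVneq j i; first by rewrite msi tpermL /ms mem_head.
    rewrite tpermD 1?eq_sym ?ms_neq ?(ms_neq_m k) //.
    by rewrite /ms inE (negPf ji).
  by rewrite /ms inE; case: eqVneq iV => // <-; rewrite jV.
(* When [i] is in [A] and [m i] is not, the exchange can only lose arrivals for the factors in [f],
   which do not read [m i], and only gain them for those in [g], which do not read [i]. *)
apply: bernoulli_expect_swap_le => // A iA miA; split.
  apply: ler_prod => k iV; rewrite X0 XV //; apply/subsetP=> j.
  rewrite !inE => /andP[jA jV]; move: jA.
  have [->|ji] := eqVneq j i; first by rewrite msi.
  by rewrite tpermD 1?eq_sym ?ms_neq ?(ms_neq_m k).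
apply: ler_prod => k iV; rewrite X0 XV //; apply/subsetP=> j.
rewrite !inE => /andP[jA jV].
have ji : j != i by apply: contra iV => /eqP <-.
rewrite tpermD // eq_sym ?ms_neq //.
by apply: contra miA => /eqP <-.
Qed.

End Bernoulli.

(** * Transfer to a probability space independent of the contract *)

Lemma outcome_prob_marginal (R : realFieldType) (K H : finType) (p : H -> R)
    (P : H -> {set {set K}}) (B : {set H * {set K}}) :
  B \subset shipments P ->
  \sum_(A | A :&: shipments P == B)
     bernoulli_prob (fun s => p s.1) A = outcome_prob p P B.
Proof.
move=> sB; pose S := shipments P.
(* In the expansion of the product of [f s + g s], the terms that disagree with [B] on [S] vanish;
   off [S] each factor sums to 1. *)
pose f s := if (s \in S) ==> (s \in B) then p s.1 else 0.
pose g s := if (s \in S) ==> (s \notin B) then 1 - p s.1 else 0.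
have -> : outcome_prob p P B = \prod_s (f s + g s).
  rewrite /outcome_prob big_mkcond; apply: eq_bigr => s _; rewrite /f /g -/S.
  case: (s \in S) => /=; last by rewrite addrC subrK.
  by case: (s \in B); rewrite /= ?addr0 ?add0r.
rewrite bigA_distr big_mkcond; apply: eq_bigr => A _; rewrite -/S.
case: eqVneq => [AB|neq].
  apply: eq_bigr => s _; rewrite /f /g -AB -/S in_setI.
  by case: (s \in A); case: (s \in S).
have /existsP[s] : [exists s, (s \in A :&: S) != (s \in B)].
  by apply: contraR neq => /existsPn AB; apply/eqP/setP=> s; apply/eqP/negPn/AB.
rewrite inE (bigD1 s) //= /f /g; move/(_ s): (subsetP sB); rewrite -/S.
case: (s \in A); case: (s \in S); case: (s \in B) => //= sBS;
  by rewrite ?mul0r //; move: (sBS isT).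
Qed.

(** Every pair of a supplier and a set becomes a potential shipment, so that two contract tuples can
    be compared under one law. *)
Lemma expectationE (R : realFieldType) (K H : finType) (p : H -> R)
    (P : H -> {set {set K}}) (X : {set H * {set K}} -> R) :
  (forall A, X (A :&: shipments P) = X A) ->
  expectation p P X = bernoulli_expect (fun s => p s.1) X.
Proof.
move=> XS; rewrite /bernoulli_expect.
rewrite (partition_big (fun A => A :&: shipments P)
                       (fun A => A \subset shipments P)) /=; last first.
  by move=> A _; apply: subsetIr.
apply: eq_bigr => B sB; rewrite -outcome_prob_marginal // mulr_suml.
by apply: eq_bigr => A /eqP <-; rewrite XS.
Qed.

Lemma expected_outputE (R : realFieldType) (K H : finType) (Kh : H -> {set K})
    (p : H -> R) (F : K -> {set H} -> R) (P : H -> {set {set K}}) :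
  contract_tuple Kh P ->
  expected_output Kh p F P =
  bernoulli_expect (fun s => p s.1)
    (fun A => \prod_k F k (arrived_suppliers Kh P A k)).
Proof.
move=> cP; apply: expectationE => A; apply: eq_bigr => k _; congr (F k _).
apply/setP=> h; rewrite !inE; case: (boolP (k \in Kh h)) => //= kh.
by rewrite pblock_mem ?andbT // (cover_partition (cP h)).
Qed.

(** * Merging the shipments of a finer contract *)

Lemma coarser_pblock (K : finType) (U : {set K}) (P Q : {set {set K}})
    (x k : K) :
    partition P U -> partition Q U -> coarser P Q -> k \in U ->
  x \in pblock Q k -> pblock P x = pblock P k.
Proof.
move=> pP pQ PQ kU xQ; have tP := partition_trivIset pP.
have kP : k \in cover P by rewrite (cover_partition pP).
have [D sD defB] := PQ _ (pblock_mem kP).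
apply: same_pblock => //; rewrite defB.
(* The part of [D] containing [k] is [pblock Q k], which brings [x] into the same part of [P]. *)
have /bigcupP[C CD kC] : k \in cover D by rewrite -defB mem_pblock.
apply/bigcupP; exists C => //.
by rewrite -(def_pblock (partition_trivIset pQ) (subsetP sD _ CD) kC).
Qed.

(* The shipment of [P] into which a shipment of a finer contract is merged; it
   is given by an arbitrary commodity of the latter. *)
Definition merge_into (K H : finType) (P : H -> {set {set K}})
    (s : H * {set K}) : H * {set K} :=
  (s.1, if [pick x in s.2] is Some x then pblock (P s.1) x else s.2).

(** This covers pairs that are not shipments: a commodity outside [Kh] gives the block [set0], which
    is left fixed. *)
Lemma merge_into_idem (K H : finType) (Kh : H -> {set K})
    (P : H -> {set {set K}}) (s : H * {set K}) :
  contract_tuple Kh P ->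
  merge_into P (merge_into P s) = merge_into P s.
Proof.
move=> cP; case: s => h D; rewrite /merge_into /=; congr (_, _).
case: (pickP (mem D)) => [x _|D0] /=.
  by case: pickP => //= y yP; apply: same_pblock (partition_trivIset (cP h)) _.
by case: pickP => //= x; move: (D0 x) => /= ->.
Qed.

Lemma expected_output_monotone (R : realFieldType) (K H : finType)
    (Kh : H -> {set K}) (p : H -> R) (F : K -> {set H} -> R)
    (P Q : H -> {set {set K}}) :
    (forall h, 0 <= p h <= 1) -> (forall k S, 0 <= F k S) ->
    (forall k (S S' : {set H}), S' \subset S -> F k S' <= F k S) ->
    contract_tuple Kh P -> contract_tuple Kh Q -> coarser_tuple P Q ->
  expected_output Kh p F Q <= expected_output Kh p F P.
Proof.
move=> p01 F0 Fmono cP cQ PQ; rewrite !expected_outputE //.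
pose V k := [set s : H * {set K} |
              (k \in Kh s.1) && (s.2 == pblock (Q s.1) k)].
pose X k A := F k (arrived_suppliers Kh Q A k).
(* Reading [P] on [A] amounts to letting each shipment of [Q] arrive exactly when its merged
   shipment is in [A]. *)
have -> : bernoulli_expect (fun s => p s.1)
            (fun A => \prod_k F k (arrived_suppliers Kh P A k)) =
          bernoulli_expect (fun s => p s.1)
            (fun A => \prod_k X k (merge_into P @^-1: A)).
  apply: eq_bigr => A _; congr (_ * _); apply: eq_bigr => k _; congr (F k _).
  apply/setP=> h; rewrite !inE; case: (boolP (k \in Kh h)) => //= kh.
  congr (_ \in A); rewrite /merge_into /=; congr (_, _).
  case: pickP => [x xQ|Q0].
    by rewrite (coarser_pblock (cP h) (cQ h) (PQ h) kh xQ).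
  by have := Q0 k; rewrite /= mem_pblock (cover_partition (cQ h)) kh.
apply: (bernoulli_expect_merge_le _ (V := V)) => //.
- move=> k A B /subsetP AB; apply: Fmono; apply/subsetP=> h.
  rewrite !inE => /andP[kh hA]; rewrite kh AB //.
  by rewrite in_setI hA inE /= kh eqxx.
- by move=> s; apply: merge_into_idem cP.
(* Merging keeps the supplier, which determines the element of [V k]. *)
- move=> k [h D] [h' D']; rewrite !inE /=.
  by move=> /andP[_ /eqP->] /andP[_ /eqP->] [->].
Qed.

Lemma coarse_contract (K H : finType) (Kh : H -> {set K}) :
  contract_tuple Kh (coarse_tuple Kh).
Proof.
move=> h; rewrite /coarse_tuple; have [->|nz] := eqVneq (Kh h) set0.
  by rewrite setDv partition_set0.
have -> : [set Kh h] :\ set0 = [set Kh h].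
  by apply/setDidPl; rewrite disjoints1 inE.
rewrite /partition /cover /trivIset /cover !big_set1 !eqxx inE eq_sym.
by rewrite nz.
Qed.

Lemma coarse_coarser (K H : finType) (Kh : H -> {set K})
    (Q : H -> {set {set K}}) :
  contract_tuple Kh Q -> coarser_tuple (coarse_tuple Kh) Q.
Proof.
move=> cQ h B; rewrite !inE => /andP[_ /eqP->].
by exists (Q h); rewrite // (cover_partition (cQ h)).
Qed.

Theorem proposition6 (R : realFieldType) (K H : finType)
    (Kh : H -> {set K}) (p : H -> R) (F : K -> {set H} -> R)
    (hp : forall h : H, 0 <= p h <= 1)
    (hF0 : forall (k : K) (S : {set H}), 0 <= F k S)
    (hFmono : forall (k : K) (S S' : {set H}), S' \subset S -> F k S' <= F k S) :
  (forall P Q : H -> {set {set K}},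
     contract_tuple Kh P -> contract_tuple Kh Q -> coarser_tuple P Q ->
     expected_output Kh p F Q <= expected_output Kh p F P) /\
  (contract_tuple Kh (coarse_tuple Kh) /\
   forall Q : H -> {set {set K}}, contract_tuple Kh Q ->
     expected_output Kh p F Q <= expected_output Kh p F (coarse_tuple Kh)).
Proof.
have mono P Q := @expected_output_monotone R K H Kh p F P Q hp hF0 hFmono.
split; first exact: mono.
split=> [|Q cQ]; first exact: coarse_contract.
by apply: mono => //; [exact: coarse_contract | exact: coarse_coarser].
Qed.
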